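(* Let $\mathbb{F}_Q$ be the finite field with $Q$ elements, $d\ge1$, $n\ge0$. Let $q\in\mathbb{F}_Q^d$ be nonzero and let $A_n\in\mathbb{F}_Q^{n\times d}$ have independent uniform rows $a_1^\top,\dots,a_n^\top$ in $\mathbb{F}_Q^d$. Then \[ \mathbb{P}\bigl(q\in\operatorname{Row}(A_n)\bigr)=\sum_{r=0}^{\min(n,d)}R_{n,d,Q}(r)\,\frac{Q^r-1}{Q^d-1}. \] Equivalently, the probability that the answer to the fixed query $q$ is semantically determined after $n$ random examples (with labels $b_i=(w^\ast)^\top a_i$ generated by a fixed latent parameter $w^\ast\in\mathbb{F}_Q^d$) is the expression above. The zero query is determined with probability $1$ for every $n$.
   Context: For $0\le r\le\min(n,d)$, \[ R_{n,d,Q}(r):=\frac{1}{Q^{nd}}\,\frac{\prod_{i=0}^{r-1}(Q^n-Q^i)(Q^d-Q^i)}{\prod_{i=0}^{r-1}(Q^r-Q^i)}, \] with empty products equal to $1$; this is the probability that a uniformly random $n\times d$ matrix over $\mathbb{F}_Q$ has rank $r$. $\operatorname{Row}(A_n)\subseteq\mathbb{F}_Q^d$ is the span of the rows of $A_n$. A query $q$ is semantically determined if $w^\top q$ takes the same value for all $w\in W_n=\{w\in\mathbb{F}_Q^d: w^\top a_i=b_i,\ 1\le i\le n\}$. *)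

(* Defs.v *)
From HB Require Import structures.
From mathcomp Require Export all_boot all_order all_algebra.
From mathcomp Require Export all_classical all_reals all_analysis.
Set Implicit Arguments.
Unset Strict Implicit.
Unset Printing Implicit Defensive.
Import Order.TTheory GRing.Theory Num.Theory.
Local Open Scope classical_set_scope.
Local Open Scope ring_scope.

(* Random variables with values in a finite type V, which carries the
   discrete sigma-algebra: every B : set V is measurable. *)
Definition discrete_rv (dT : measure_display) (T : measurableType dT)
    (V : finType) (X : T -> V) : Prop :=
  forall B : set V, measurable (X @^-1` B).

Definition uniform_rv (R : realType) (dT : measure_display)
    (T : measurableType dT) (P : probability T R) (V : finType)
    (X : T -> V) : Prop :=
  forall v : V, P (X @^-1` [set v]) = ((#|V|%:R : R)^-1)%:E.

(* Mutual independence: the product rule over every subfamily J. *)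
Definition independent_rvs (R : realType) (dT : measure_display)
    (T : measurableType dT) (P : probability T R) (I V : finType)
    (X : I -> T -> V) : Prop :=
  forall (J : {set I}) (B : I -> set V),
    P [set t | forall i, i \in J -> B i (X i t)] =
    (\prod_(i in J) P (X i @^-1` B i))%E.

Definition dotcv (F : pzRingType) (d : nat) (w x : 'cV[F]_d) : F :=
  (w^T *m x) ord0 ord0.

Definition rows_mx (F : pzRingType) (n d : nat) (a : 'I_n -> 'cV[F]_d) :
    'M[F]_(n, d) :=
  \matrix_(i < n) (a i)^T.

(* Row(A), the span of the rows of A, as a set of column vectors. *)
Definition row_span (F : fieldType) (n d : nat) (A : 'M[F]_(n, d)) :
    set 'cV[F]_d :=
  [set q | (q^T <= A)%MS].

(* W_n, the parameters w consistent with the examples (a_i, b_i). *)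
Definition consistent (F : pzRingType) (n d : nat)
    (a : 'I_n -> 'cV[F]_d) (b : 'I_n -> F) : set 'cV[F]_d :=
  [set w | forall i, dotcv w (a i) = b i].

Definition sem_determined (F : pzRingType) (n d : nat)
    (a : 'I_n -> 'cV[F]_d) (b : 'I_n -> F) (q : 'cV[F]_d) : Prop :=
  forall w w', consistent a b w -> consistent a b w' ->
    dotcv w q = dotcv w' q.

Definition rank_prob (R : realType) (n d Q r : nat) : R :=
  let x : R := Q%:R in
  (x ^+ (n * d))^-1 *
  ((\prod_(0 <= i < r) ((x ^+ n - x ^+ i) * (x ^+ d - x ^+ i))) /
   (\prod_(0 <= i < r) (x ^+ r - x ^+ i))).

Definition determination_prob (R : realType) (n d Q : nat) : R :=
  \sum_(0 <= r < (minn n d).+1)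
    rank_prob R n d Q r * ((Q%:R ^+ r - 1) / (Q%:R ^+ d - 1)).

(* Main.v *)
(* Independence and uniformity make the random matrix uniform over all n x d
   matrices, so the probability counts the matrices A whose row space contains
   q.
   This count is the same for every nonzero q, since the general linear group is
   transitive on nonzero vectors; counting the pairs (A, q) therefore expresses
   it as the sum over A of (Q^rank A - 1) / (Q^d - 1). Sums of functions of the
   rank are computed by adjoining one row at a time: a new row lies in the
   current row space, of rank r, in Q^r cases out of Q^d, and otherwise raises
   the rank by one. *)
Require Import Defs.
From mathcomp Require Import all_boot all_order all_algebra.
From mathcomp Require Import all_classical all_reals all_analysis.
From mathcomp Require Import mxabelem ring.
Set Implicit Arguments.
Unset Strict Implicit.
Unset Printing Implicit Defensive.
Import Order.TTheory GRing.Theory Num.Theory.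
Local Open Scope classical_set_scope.
Local Open Scope ring_scope.

(** * Algebra of the rank counts *)

(** [rank_prob] without its factor [(x ^+ (n * d))^-1]: at [x = #|F|], the number of [n] by [d]
    matrices of rank [r]. *)
Definition rank_count (R : fieldType) (x : R) (n d r : nat) : R :=
  (\prod_(0 <= i < r) ((x ^+ n - x ^+ i) * (x ^+ d - x ^+ i))) /
  (\prod_(0 <= i < r) (x ^+ r - x ^+ i)).

Lemma rank_count0 (R : fieldType) (x : R) (n d : nat) :
  rank_count x n d 0 = 1.
Proof. by rewrite /rank_count !big_nil divr1. Qed.

Lemma rank_count_gtl (R : fieldType) (x : R) (n d r : nat) :
  (n < r)%N -> rank_count x n d r = 0.
Proof.
move=> nr; rewrite /rank_count big_mkord (bigD1 (Ordinal nr)) //=.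
by rewrite subrr !mul0r.
Qed.

Lemma rank_count_gtr (R : fieldType) (x : R) (n d r : nat) :
  (d < r)%N -> rank_count x n d r = 0.
Proof.
move=> dr; rewrite /rank_count big_mkord (bigD1 (Ordinal dr)) //=.
by rewrite subrr mulr0 !mul0r.
Qed.

Lemma prod_subX_shift (R : comPzRingType) (x : R) (n r : nat) :
  \prod_(0 <= i < r.+1) (x ^+ n.+1 - x ^+ i) =
  (x ^+ n.+1 - 1) * x ^+ r * \prod_(0 <= i < r) (x ^+ n - x ^+ i).
Proof.
rewrite big_nat_recl // expr0 -mulrA; congr (_ * _).
under eq_bigr do rewrite !exprS -mulrBr.
by rewrite big_split /= prodr_const_nat subn0.
Qed.

(** Mirrors adjoining a row, which lies in a row space of rank [r.+1] or enlarges one of rank [r].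
    Algebraically, [prod_subX_shift] lowers [n.+1] and [r.+1], leaving a rational identity whose
    denominators are nonzero because [1 < x]. *)
Lemma rank_count_rec (R : realFieldType) (x : R) (n d r : nat) : 1 < x ->
  rank_count x n.+1 d r.+1 =
  x ^+ r.+1 * rank_count x n d r.+1 + (x ^+ d - x ^+ r) * rank_count x n d r.
Proof.
move=> x1; have x0 : x != 0 by rewrite gt_eqF // (lt_trans ltr01).
have xr0 : x ^+ r != 0 by rewrite expf_neq0.
have xr1 : x * x ^+ r - 1 != 0.
  by rewrite -exprS subr_eq0 gt_eqF // exprn_egt1.
have P0 : \prod_(0 <= i < r) (x ^+ r - x ^+ i) != 0.
  rewrite big_mkord; apply/prodf_neq0 => i _.
  by rewrite subr_eq0 gt_eqF // ltr_eXn2l.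
rewrite /rank_count !big_split /= !prod_subX_shift.
rewrite !(big_nat_recr r) //= !exprS.
by field; rewrite P0 xr0 -?exprS ?x0; rewrite exprS xr1.
Qed.

(** * Sums over matrices by rank *)

Lemma mxrank_col_mx_row (F : fieldType) (n d : nat) (v : 'rV[F]_d)
    (A : 'M[F]_(n, d)) :
  \rank (col_mx v A) = (\rank A + ~~ (v <= A)%MS)%N.
Proof.
rewrite -addsmxE; have [vA|vA] := boolP (v <= A)%MS.
  rewrite addn0; apply/eqmx_rank/andP.
  by rewrite addsmxSr addsmx_sub vA submx_refl.
have v0 : v != 0 by apply: contraNneq vA => ->; rewrite sub0mx.
(* A proper subspace of a line is zero, so the ranks of [v] and [A] add up. *)
have /rank_ltmx : (v :&: A < v)%MS.
  by rewrite ltmxE capmxSl sub_capmx submx_refl.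
rewrite rank_rV v0 ltnS leqn0 => /eqP c0.
by have := mxrank_sum_cap v A; rewrite c0 rank_rV v0 addn0 addnC.
Qed.

Lemma card_submx (F : finFieldType) (n d : nat) (A : 'M[F]_(n, d)) :
  #|[pred v : 'rV[F]_d | (v <= A)%MS]| = (#|F| ^ \rank A)%N.
Proof.
by rewrite -card_rowg; apply: eq_card => v; rewrite mem_rowg.
Qed.

(** Induction on [n] with [g] arbitrary: summing over the added row turns [g] into another function
    of the rank of the remaining rows, to which the induction hypothesis applies. *)
Lemma sum_mxrank (R : realFieldType) (F : finFieldType) (n d : nat)
    (g : nat -> R) :
  \sum_(A : 'M[F]_(n, d)) g (\rank A) =
  \sum_(0 <= r < n.+1) rank_count #|F|%:R n d r * g r.
Proof.
set x : R := #|F|%:R.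
have x1 : 1 < x by rewrite ltr1n card_finNzRing_gt1.
elim: n g => [|n IHn] g.
  rewrite big_nat1 rank_count0 mul1r (big_pred1 (0 : 'M[F]_(0, d))) ?mxrank0 //.
  by move=> A /=; rewrite [A]flatmx0 eqxx.
transitivity (\sum_(A : 'M[F]_(n, d))
    (x ^+ \rank A * g (\rank A) + (x ^+ d - x ^+ \rank A) * g (\rank A).+1)).
  rewrite (reindex (fun p : 'rV[F]_d * 'M[F]_(n, d) => col_mx p.1 p.2)) /=;
    last first.
    exists (fun B : 'M[F]_(1 + n, d) => (usubmx B, dsubmx B)) => [[v A]|B] _ /=.
      by rewrite col_mxKu col_mxKd.
    exact: vsubmxK.
  rewrite -(pair_bigA _ (fun v A => g (\rank (col_mx v A)))) /= exchange_big /=.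
  apply: eq_bigr => A _; rewrite (bigID [pred v | (v <= A)%MS]) /=.
  have cA : #|[pred v : 'rV[F]_d | ~~ (v <= A)%MS]|%:R = x ^+ d - x ^+ \rank A.
    have := cardC [pred v : 'rV[F]_d | (v <= A)%MS].
    rewrite card_submx card_mx mul1n => /(congr1 (fun k => k%:R : R)).
    by rewrite natrD !natrX => <-; rewrite addrAC subrr add0r.
  congr (_ + _).
    under eq_bigr => v vA do rewrite mxrank_col_mx_row vA addn0.
    by rewrite sumr_const card_submx -mulr_natl natrX.
  under eq_bigr => v vA do rewrite mxrank_col_mx_row vA addn1.
  by rewrite sumr_const -mulr_natl cA.
rewrite (IHn (fun r => x ^+ r * g r + (x ^+ d - x ^+ r) * g r.+1)).
under eq_bigr do rewrite mulrDr.
(* The recursion only reaches ranks [r.+1], so rank 0 is split off. *)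
rewrite big_split /= [RHS]big_nat_recl //= rank_count0 mul1r.
under [in RHS]eq_bigr do rewrite rank_count_rec // mulrDl.
rewrite big_split /= addrA; congr (_ + _); last first.
  by apply: eq_bigr => r _; ring.
rewrite big_nat_recl // rank_count0 expr0 !mul1r; congr (_ + _).
(* The top term has rank [n.+1] with only [n] rows, hence vanishes, and the two ranges agree. *)
rewrite [RHS]big_nat_recr //= rank_count_gtl // mulr0 mul0r addr0.
by apply: eq_bigr => r _; ring.
Qed.

(** * Transitivity and double counting *)

Lemma rV_transitive (F : fieldType) (d : nat) (u v : 'rV[F]_d) :
  u != 0 -> v != 0 -> exists2 g : 'M[F]_d, g \in unitmx & u *m g = v.
Proof.
(* [pinvmx u *m v] sends [u] to [v] but has rank one; [complete_unitmx] replaces it by an invertible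
   matrix with the same value at [u]. *)
move=> u0 v0; have E : u *m (pinvmx u *m v) = v.
  by rewrite mulmxA mulmxVp ?mul1mx // /row_free rank_rV u0.
have [|g gU ug] := @complete_unitmx _ _ _ u (pinvmx u *m v).
  by rewrite E !rank_rV u0 v0.
by exists g => //; rewrite -ug.
Qed.

(** Right multiplication by an invertible [g] with [u *m g = v] permutes the matrices and carries
    [u <= A] to [v <= A *m g]. *)
Lemma card_row_space_transitive (F : finFieldType) (n d : nat)
    (u v : 'rV[F]_d) : u != 0 -> v != 0 ->
  #|[pred A : 'M[F]_(n, d) | (u <= A)%MS]| =
  #|[pred A : 'M[F]_(n, d) | (v <= A)%MS]|.
Proof.
move=> u0 v0; have [g gU <-] := rV_transitive u0 v0.
have gK : cancel (mulmx^~ g) (mulmx^~ (invmx g) : 'M[F]_(n, d) -> _).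
  by move=> A /=; rewrite mulmxK.
have gK' : cancel (mulmx^~ (invmx g)) (mulmx^~ g : 'M[F]_(n, d) -> _).
  by move=> A /=; rewrite mulmxKV.
rewrite -!sum1_card [RHS](reindex (mulmx^~ g : 'M[F]_(n, d) -> _)) /=;
  last first.
  by exists (mulmx^~ (invmx g)) => A _.
by apply: eq_bigl => A; rewrite /= !inE submxMfree // row_free_unit.
Qed.

Lemma card_row_space_prob (R : realType) (F : finFieldType) (n d : nat)
    (v : 'rV[F]_d) : v != 0 ->
  #|[pred A : 'M[F]_(n, d) | (v <= A)%MS]|%:R / #|F|%:R ^+ (n * d) =
  determination_prob R n d #|F|.
Proof.
move=> v0; set x : R := #|F|%:R; set c := #|_|.
have x1 : 1 < x by rewrite ltr1n card_finNzRing_gt1.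
have d0 : (0 < d)%N.
  by case: d v v0 {c} => // v; rewrite [v]thinmx0 eqxx.
have xd : x ^+ d - 1 != 0.
  by rewrite subr_eq0 gt_eqF // exprn_egt1 // -lt0n.
(* Count pairs of a nonzero [u] and an [A] whose row space contains it: each [A] contributes
   [x ^+ \rank A - 1], each [u] contributes [c]. *)
have count : c%:R * (x ^+ d - 1) = \sum_(A : 'M[F]_(n, d)) (x ^+ \rank A - 1).
  have -> : \sum_(A : 'M[F]_(n, d)) (x ^+ \rank A - 1) =
      \sum_(A : 'M[F]_(n, d)) \sum_(u : 'rV[F]_d | u != 0) (u <= A)%MS%:R.
    apply: eq_bigr => A _.
    rewrite -natrX -card_submx -sum1_card.
    rewrite (bigD1 (0 : 'rV[F]_d)) ?inE ?sub0mx //=.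
    rewrite natrD addrAC subrr add0r natr_sum big_mkcond [RHS]big_mkcond /=.
    by apply: eq_bigr => u _; rewrite inE; case: (u <= A)%MS; case: (u != 0).
  rewrite exchange_big /=.
  rewrite (eq_bigr (fun=> c%:R)) => [|u u0].
    rewrite sumr_const -[RHS]mulr_natr; congr (_ * _).
    have -> : x ^+ d = #|{: 'rV[F]_d}|%:R by rewrite card_mx mul1n natrX.
    rewrite [in LHS](cardD1 (0 : 'rV[F]_d)) inE natrD addrAC subrr add0r.
    by congr (_ *+ _); apply: eq_card => u; rewrite !inE andbT.
  rewrite /c -(card_row_space_transitive n u0 v0) -sum1_card natr_sum.
  by rewrite [RHS]big_mkcond;
    apply: eq_bigr => A _; rewrite inE; case: (u <= A)%MS.
have -> : c%:R = (\sum_(A : 'M[F]_(n, d)) (x ^+ \rank A - 1)) / (x ^+ d - 1).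
  by rewrite -count mulfK.
rewrite (sum_mxrank F n d (fun r => x ^+ r - 1)) /determination_prob -/x.
(* In the tail [minn n d < r <= n], so [d < r] and the rank counts vanish. *)
rewrite (@big_cat_nat _ _ _ (minn n d).+1 0 n.+1) //=; last first.
  by rewrite ltnS geq_minl.
rewrite [X in _ + X]big_nat_cond.
rewrite [X in _ + X]big1 ?addr0 => [|r /andP[/andP[mr rn] _]].
  rewrite !big_distrl /=; apply: eq_bigr => r _.
  by rewrite /rank_prob -/x /rank_count; ring.
rewrite rank_count_gtr ?mul0r //.
by move: mr; rewrite gtn_min ltnNge -ltnS rn.
Qed.

(** * Determined queries *)

Lemma dotcv_trmx (F : comPzRingType) (d : nat) (w x : 'cV[F]_d) :
  dotcv w x = (x^T *m w) ord0 ord0.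
Proof. by rewrite /dotcv -[in LHS](trmxK x) -trmx_mul mxE. Qed.

(** The consistent set is the coset of [wstar] modulo the kernel of the row matrix, so [q] is
    determined exactly when it annihilates that kernel, that is, when it lies in the row space. *)
Lemma sem_determinedE (F : fieldType) (n d : nat) (a : 'I_n -> 'cV[F]_d)
    (wstar q : 'cV[F]_d) :
  sem_determined a (fun i => dotcv wstar (a i)) q <-> row_span (rows_mx a) q.
Proof.
have aE w i : dotcv w (a i) = (rows_mx a *m w) i ord0.
  by rewrite dotcv_trmx -(rowK (fun i => (a i)^T) i) -row_mul mxE.
rewrite /row_span /=; split=> [det|/submxP[u qE] w w' Hw Hw'].
  rewrite submxE; apply/eqP/matrixP => i j; rewrite [i]ord1 [RHS]mxE.
  (* The columns of [C] lie in the kernel, so translating [wstar] by one keeps it consistent. *)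
  set C := cokermx _; pose w := wstar + col j C.
  have Hw : consistent a (fun i => dotcv wstar (a i)) w.
    by move=> k; rewrite !aE mulmxDr colE mulmxA mulmx_coker mul0mx addr0.
  have := det wstar w (fun=> erefl) Hw; rewrite !dotcv_trmx mulmxDr [RHS]mxE.
  move/esym/eqP; rewrite -subr_eq0 addrAC subrr add0r => /eqP E0.
  by rewrite -E0 [in RHS]colE [in RHS]mulmxA -[in RHS]colE [RHS]mxE.
have E y : dotcv y q = (u *m (rows_mx a *m y)) ord0 ord0.
  by rewrite dotcv_trmx qE mulmxA.
rewrite !E (_ : rows_mx a *m w = rows_mx a *m w') //.
by apply/matrixP => i j; rewrite [j]ord1 -!aE Hw Hw'.
Qed.

(** * From probabilities to counts *)

Lemma discrete_rv_tuple (dT : measure_display) (T : measurableType dT)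
    (I V : finType) (X : I -> T -> V) (v : I -> V) :
  (forall i, discrete_rv (X i)) -> measurable [set t | forall i, X i t = v i].
Proof.
move=> mX.
have -> : [set t | forall i, X i t = v i] =
    \bigcap_(i in [set: I]) (X i @^-1` [set v i]).
  by apply/seteqP; split=> t /= h i => [_|]; apply: h.
by apply: fin_bigcap_measurable => [|i _]; [exact: finite_finset | exact: mX].
Qed.

Lemma uniform_rv_tuple (R : realType) (dT : measure_display)
    (T : measurableType dT) (P : probability T R) (I V : finType)
    (X : I -> T -> V) (v : I -> V) :
  (forall i, uniform_rv P (X i)) -> independent_rvs P X ->
  P [set t | forall i, X i t = v i] = ((#|V|%:R ^+ #|I|)^-1)%:E.
Proof.
move=> uX /(_ [set: I]%SET (fun i => [set v i])).
have -> : [set t | forall i, i \in [set: I]%SET -> [set v i] (X i t)] =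
    [set t | forall i, X i t = v i].
  by apply/seteqP; split=> t /= h i => [|_]; apply: h; rewrite ?inE.
move=> ->; rewrite (eq_bigr (fun=> ((#|V|%:R : R)^-1)%:E)) => [|i _];
  last exact: uX.
by rewrite prodEFin prodr_const cardsT exprVn.
Qed.

Lemma rows_mxE (F : pzRingType) (n d : nat) (b : 'I_n -> 'cV[F]_d)
    (A : 'M[F]_(n, d)) : rows_mx b = A <-> forall i, b i = (row i A)^T.
Proof.
split=> [<- i|bA]; first by rewrite rowK trmxK.
by apply/row_matrixP => i; rewrite rowK bA trmxK.
Qed.

(** The event is a finite disjoint union of fibers, one for each matrix in [S], all of the same
    probability. *)
Lemma uniform_rows_mx (R : realType) (F : finFieldType) (n d : nat)
    (dT : measure_display) (T : measurableType dT) (P : probability T R)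
    (a : 'I_n -> T -> 'cV[F]_d) (S : pred 'M[F]_(n, d)) :
  (forall i, discrete_rv (a i)) -> (forall i, uniform_rv P (a i)) ->
  independent_rvs P a ->
  P [set t | S (rows_mx (fun i => a i t))] = (#|S|%:R / #|F|%:R ^+ (n * d))%:E.
Proof.
move=> ma ua ia.
pose fiber (A : 'M[F]_(n, d)) := [set t | forall i, a i t = (row i A)^T].
have -> : [set t | S (rows_mx (fun i => a i t))] =
    \bigcup_(A in [set` enum S]) fiber A.
  apply/seteqP; split=> [t St|t [A /= SA /rows_mxE tA]].
    by exists (rows_mx (fun i => a i t)); [rewrite /= mem_enum | exact/rows_mxE].
  by rewrite tA -[S A]/(A \in S) -mem_enum.
rewrite measure_fin_bigcup //; last 2 first.
- apply/trivIsetP => A B _ _; apply: contraNeq.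
  by move=> /set0P[t [/rows_mxE <- /rows_mxE <-]].
- by move=> A _; exact: discrete_rv_tuple.
rewrite -fsbig_seq ?enum_uniq // big_enum /=.
rewrite (eq_bigr (fun=> ((#|F|%:R ^+ (n * d))^-1 : R)%:E)) => [|A _].
  by rewrite sumEFin sumr_const mulr_natl.
rewrite uniform_rv_tuple // card_mx muln1 card_ord.
by rewrite natrX -exprM mulnC.
Qed.

Theorem theorem5p6 (R : realType) (F : finFieldType) (n d : nat)
  (hd : (1 <= d)%N)
  (dT : measure_display) (T : measurableType dT) (P : probability T R)
  (a : 'I_n -> T -> 'cV[F]_d)
  (a_rv : forall i, discrete_rv (a i))
  (a_unif : forall i, uniform_rv P (a i))
  (a_indep : independent_rvs P a) :
  (forall q : 'cV[F]_d, q != 0 ->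
     P [set t | row_span (rows_mx (fun i => a i t)) q] =
       (determination_prob R n d #|F|)%:E
     /\
     (forall wstar : 'cV[F]_d,
        P [set t | sem_determined (fun i => a i t)
                     (fun i => dotcv wstar (a i t)) q] =
          (determination_prob R n d #|F|)%:E))
  /\
  (forall wstar : 'cV[F]_d,
     P [set t | sem_determined (fun i => a i t)
                  (fun i => dotcv wstar (a i t)) 0] = 1%:E).

Proof.
have detE q wstar : [set t | sem_determined (fun i => a i t)
    (fun i => dotcv wstar (a i t)) q] =
    [set t | row_span (rows_mx (fun i => a i t)) q].
  by apply/seteqP; split=> t /= /sem_determinedE.
split=> [q q0|wstar].
  have Pq : P [set t | row_span (rows_mx (fun i => a i t)) q] =
      (determination_prob R n d #|F|)%:E.
    rewrite -(@card_row_space_prob R F n d q^T) ?trmx_eq0 //.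
    exact: (uniform_rows_mx [pred A | (q^T <= A)%MS]).
  by split=> // wstar; rewrite detE.
rewrite detE (_ : [set _ | _] = setT) ?probability_setT //.
by apply/seteqP; split=> t //= _; rewrite /row_span /= trmx0 sub0mx.
Qed.
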